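(* Let $G$ be a connected graph of order $n$ with $m$ edges, maximum degree $\Delta$, minimum non-pendent vertex degree $\delta_1$, and $p$ pendent vertices. Then \[ AG(G) \ge \frac{p(\delta_1+1)}{2\sqrt{\delta_1}} + \frac{1}{2\Delta}\bigl(M_1 - p(\Delta+1)\bigr), \] with equality if and only if $G$ is isomorphic to $K_{1,n-1}$, or $G$ is a regular graph, or $G$ is a $(\Delta,1)$-semiregular graph.
   Context: All graphs are finite, simple and undirected. $d_i$ is the degree of vertex $v_i$; $i\sim j$ denotes an edge $v_iv_j$ and sums over $i\sim j$ run over edges, each once. A pendent vertex is a vertex of degree $1$; $p$ is the number of pendent vertices; $\delta_1$ is the minimum degree among non-pendent vertices. $AG(G)=\sum_{i\sim j}\frac12\left(\sqrt{d_i/d_j}+\sqrt{d_j/d_i}\right)$, $M_1(G)=\sum_i d_i^2=\sum_{i\sim j}(d_i+d_j)$. A graph is $(s,r)$-semiregular if its vertex set is the disjoint union of two nonempty sets $V_1,V_2$ with all vertices of $V_1$ of degree $s$ and all vertices of $V_2$ of degree $r$. $K_{1,n-1}$ is the star. *)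

(* Defs.v *)
From mathcomp Require Import all_boot all_order all_algebra.

Set Implicit Arguments.
Unset Strict Implicit.
Unset Printing Implicit Defensive.

Import Order.TTheory GRing.Theory Num.Theory.

Record sgraph (V : finType) := SGraph {
  adj : rel V;
  adj_sym : symmetric adj;
  adj_irr : irreflexive adj
}.

Section Graph.
Variables (V : finType) (G : sgraph V).

(* Each edge is listed once, as the pair of its endpoints taken in the
   order of the enumeration of V. *)
Definition edges : {set V * V} :=
  [set e | adj G e.1 e.2 && (enum_rank e.1 < enum_rank e.2)].

Definition degree (v : V) : nat := #|[set w | adj G v w]|.

Definition max_degree : nat := \max_v degree v.

Definition pendent (v : V) : bool := degree v == 1.

Definition num_pendent : nat := #|[set v | pendent v]|.

(* Every degree is at most the maximum degree, so the initial value is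
   irrelevant as soon as a non-pendent vertex exists. For a connected graph,
   only K_2 has none; the value there is then 1. *)
Definition min_nonpendent_degree : nat :=
  \big[minn/max_degree]_(v | ~~ pendent v) degree v.

Definition connected_graph : Prop :=
  0 < #|V| /\ forall x y : V, connect (adj G) x y.

Definition first_zagreb : nat := \sum_v degree v ^ 2.

Definition AG_index (R : rcfType) : R :=
  (\sum_(e in edges)
    2^-1 * (Num.sqrt ((degree e.1)%:R / (degree e.2)%:R)
            + Num.sqrt ((degree e.2)%:R / (degree e.1)%:R)))%R.

Definition regular_graph : Prop := exists k, forall v, degree v = k.

(* The two classes need not be independent sets. *)
Definition semiregular (s r : nat) : Prop :=
  exists V1 V2 : {set V},
    [/\ V1 :|: V2 = setT, [disjoint V1 & V2], V1 != set0 /\ V2 != set0,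
        forall v, v \in V1 -> degree v = s
      & forall v, v \in V2 -> degree v = r].

End Graph.

Definition isomorphic (V W : finType) (G : sgraph V) (H : sgraph W) : Prop :=
  exists2 f : V -> W, bijective f & forall x y, adj H (f x) (f y) = adj G x y.

Section CompleteBipartite.
Variables a b : nat.

Definition in_left (x : 'I_a + 'I_b) : bool := if x is inl _ then true else false.

Definition cbip_adj (x y : 'I_a + 'I_b) : bool := in_left x != in_left y.

Lemma cbip_adj_sym : symmetric cbip_adj.
Proof. by move=> x y; rewrite /cbip_adj eq_sym. Qed.

Lemma cbip_adj_irr : irreflexive cbip_adj.
Proof. by move=> x; rewrite /cbip_adj eqxx. Qed.

Definition complete_bipartite : sgraph ('I_a + 'I_b)%type :=
  SGraph cbip_adj_sym cbip_adj_irr.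

End CompleteBipartite.

(* Main.v *)
(* Since M_1 is the sum of d_i + d_j over the edges and p that of
   [d_i = 1] + [d_j = 1], the difference between AG(G) and the bound is a sum
   over the edges of terms that depend only on the two end degrees. A pendent
   edge with other end degree d contributes f(d) - f(delta_1) +
   (Delta - d) / (2 Delta), where f(x) = (x + 1) / (2 sqrt x) increases on
   [1, +oo[; a non-pendent one contributes
   (d_i + d_j) / 2 * (1 / sqrt (d_i d_j) - 1 / Delta). All are nonnegative, and
   all vanish exactly when every degree is 1 or Delta. In the exceptional edge
   with two pendent ends, G is K_2 and the term is 0. *)
Require Import Defs.
From HB Require Import structures.
From mathcomp Require Import all_boot all_order all_algebra.
From mathcomp Require Import ring lra.
Import Order.TTheory GRing.Theory Num.Theory.
Local Open Scope ring_scope.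

(** * Real inequalities for the contribution of one edge, in terms of its end degrees *)

Section EdgeExcess.
Set Implicit Arguments.
Unset Strict Implicit.
Variable R : rcfType.

(** [D] and [d1] stand for Delta and delta_1. The three terms are the edge's shares of AG, of the
    p-terms gathered from both summands of the bound, and of M_1 / (2 Delta). *)
Definition edge_excess (D d1 a b : nat) : R :=
  2^-1 * (Num.sqrt (a%:R / b%:R) + Num.sqrt (b%:R / a%:R))
  - ((a == 1)%:R + (b == 1)%:R)
    * ((d1%:R + 1) / (2 * Num.sqrt d1%:R) - (D%:R + 1) / (2 * D%:R))
  - (a%:R + b%:R) / (2 * D%:R).

Lemma edge_excessC (D d1 a b : nat) : edge_excess D d1 a b = edge_excess D d1 b a.
Proof.
rewrite /edge_excess; congr (2^-1 * _ - _ * _ - _ / _); exact: addrC.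
Qed.

Lemma half_sum_sqrt_ratio (x y : R) : 0 < x -> 0 < y ->
  2^-1 * (Num.sqrt (x / y) + Num.sqrt (y / x))
  = (x + y) / (2 * (Num.sqrt x * Num.sqrt y)).
Proof.
move=> x0 y0; rewrite !sqrtrM ?ltW // !sqrtrV ?ltW //.
(* Only [x] and [y] in the numerator become squares, which leaves a rational identity in the two
   roots. *)
rewrite -{3}(sqr_sqrtr (ltW x0)) -{3}(sqr_sqrtr (ltW y0)).
have : Num.sqrt x != 0 by rewrite sqrtr_eq0 -ltNge.
have : Num.sqrt y != 0 by rewrite sqrtr_eq0 -ltNge.
move: (Num.sqrt x) (Num.sqrt y) => s t s0 t0.
by field; rewrite s0 t0.
Qed.

Lemma half_sum_sqrt_mono (x y : R) : 1 <= x -> x <= y ->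
  (x + 1) / (2 * Num.sqrt x) <= (y + 1) / (2 * Num.sqrt y).
Proof.
move=> x1 xy.
have x0 : 0 <= x by lra.
have y0 : 0 <= y by lra.
have s1 : 1 <= Num.sqrt x by rewrite -sqrtr1 ler_wsqrtr.
have st : Num.sqrt x <= Num.sqrt y by rewrite ler_wsqrtr.
rewrite -{1}(sqr_sqrtr x0) -{1}(sqr_sqrtr y0).
move: (Num.sqrt x) (Num.sqrt y) s1 st => s t s1 st.
rewrite ler_pdivrMr ?mulr_gt0; [|lra..].
rewrite mulrAC ler_pdivlMr ?mulr_gt0; [|lra..].
(* After cross-multiplication the difference of the two sides factors as this product. *)
have : 0 <= (t - s) * (s * t - 1).
  by rewrite mulr_ge0 ?subr_ge0 // -[1]mulr1 ler_pM //; lra.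
lra.
Qed.

(** Monotonicity discards f(b) - f(d1). Keeping the remainder gives both the sign of the excess and,
    when the excess is 0, [b = D]. *)
Lemma edge_excess_pendent (D d1 b : nat) : (0 < d1 <= b)%N -> (b <= D)%N -> b != 1%N ->
  (D%:R - b%:R) / (2 * D%:R) <= edge_excess D d1 1 b.
Proof.
case/andP=> d10 d1b bD b1.
have b0 : (0 < b)%N by exact: leq_trans d1b.
have D0 : (D%:R : R) != 0 by rewrite pnatr_eq0 -lt0n (leq_trans b0).
rewrite /edge_excess half_sum_sqrt_ratio ?ltr0n // eqxx (negbTE b1) sqrtr1 mul1r addr0 mul1r.
have := @half_sum_sqrt_mono d1%:R b%:R.
rewrite ler1n ler_nat => /(_ d10 d1b).
set u := _ / (2 * Num.sqrt d1%:R); set v := _ / (2 * Num.sqrt b%:R) => uv.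
rewrite [1 + b%:R]addrC -/v.
rewrite (_ : (D%:R - b%:R) / _ = (D%:R + 1) / (2 * D%:R) - (b%:R + 1) / (2 * D%:R)).
  by lra.
by field.
Qed.

(** The first factor is positive, so the sign and the zeros are those of D - sqrt(ab). *)
Lemma edge_excess_nonpendent (D d1 a b : nat) :
  (0 < a)%N -> (0 < b)%N -> (0 < D)%N -> a != 1%N -> b != 1%N ->
  edge_excess D d1 a b
  = (a%:R + b%:R) / (2 * (Num.sqrt a%:R * Num.sqrt b%:R) * D%:R)
    * (D%:R - Num.sqrt a%:R * Num.sqrt b%:R).
Proof.
move=> a0 b0 D0 a1 b1.
rewrite /edge_excess half_sum_sqrt_ratio ?ltr0n // (negbTE a1) (negbTE b1).
rewrite addr0 mul0r subr0.
have : Num.sqrt (a%:R : R) != 0 by rewrite sqrtr_eq0 -ltNge ltr0n.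
have : Num.sqrt (b%:R : R) != 0 by rewrite sqrtr_eq0 -ltNge ltr0n.
have : (D%:R : R) != 0 by rewrite pnatr_eq0 -lt0n.
move=> *; field; exact/and3P.
Qed.

Lemma edge_excess11 : edge_excess 1 1 1 1 = 0.
Proof. by rewrite /edge_excess !eqxx divr1 sqrtr1; field. Qed.

Section Bounds.
Variables D d1 a b : nat.
Hypotheses (d1_gt0 : (0 < d1)%N) (d1D : (d1 <= D)%N).
Hypotheses (aD : (0 < a <= D)%N) (bD : (0 < b <= D)%N).
Hypotheses (d1a : a != 1%N -> (d1 <= a)%N) (d1b : b != 1%N -> (d1 <= b)%N).
(** With two pendent ends the excess is 2 - 2 f(d1), negative once d1 > 1; this excludes that case,
    and connectedness will supply it. *)
Hypothesis K2 : a = 1%N -> b = 1%N -> D = 1%N.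

Lemma edge_excess_ge0 : 0 <= edge_excess D d1 a b.
Proof.
have pend c : (d1 <= c <= D)%N -> c != 1%N -> 0 <= edge_excess D d1 1 c.
  case/andP=> dc cD c1; apply: le_trans (edge_excess_pendent _ _ c1) => //.
    by rewrite divr_ge0 ?subr_ge0 ?ler_nat // mulr_ge0 ?ler0n.
  by rewrite d1_gt0.
case/andP: aD => a0 leaD; case/andP: bD => b0 lebD.
have D0 : (0 < D)%N by exact: leq_trans leaD.
have [ea|a1] := eqVneq a 1%N; have [eb|b1] := eqVneq b 1%N.
- have eD := K2 ea eb; have ed : d1 = 1%N by apply/eqP; rewrite eqn_leq -{1}eD d1D.
  by rewrite ea eb eD ed edge_excess11.
- by rewrite ea pend ?d1b.
- by rewrite eb edge_excessC pend ?d1a.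
rewrite edge_excess_nonpendent // mulr_ge0 //.
  by rewrite divr_ge0 ?addr_ge0 ?mulr_ge0 ?sqrtr_ge0 ?ler0n.
rewrite subr_ge0 -[D%:R]sqr_sqrtr ?ler0n // expr2.
by rewrite ler_pM ?sqrtr_ge0 ?ler_wsqrtr ?ler_nat.
Qed.

Lemma edge_excess_eq0_impl : edge_excess D d1 a b = 0 ->
  (a = 1%N \/ a = D) /\ (b = 1%N \/ b = D).
Proof.
have D0 : (0 < D)%N by case/andP: aD => a0; exact: leq_trans.
have DR0 : 0 < (D%:R : R) by rewrite ltr0n.
have pend c : (d1 <= c <= D)%N -> c != 1%N -> edge_excess D d1 1 c = 0 -> c = D.
  case/andP=> dc cD c1 e0; apply/eqP; rewrite eqn_leq cD /=.
  have : (D%:R - c%:R) / (2 * D%:R) <= edge_excess D d1 1 c.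
    by apply: edge_excess_pendent; rewrite ?d1_gt0.
  by rewrite e0 pmulr_lle0 ?invr_gt0 ?mulr_gt0 // subr_le0 ler_nat.
case/andP: aD => a0 leaD; case/andP: bD => b0 lebD.
have [ea|a1] := eqVneq a 1%N; have [eb|b1] := eqVneq b 1%N.
- by split; left.
- rewrite ea => /pend -> //; first by split; [left|right].
  by rewrite d1b.
- rewrite eb edge_excessC => /pend -> //; first by split; [right|left].
  by rewrite d1a.
rewrite edge_excess_nonpendent // => /eqP; rewrite mulf_eq0 => /orP[|].
  rewrite gt_eqF // divr_gt0 ?addr_gt0 ?mulr_gt0 ?sqrtr_gt0 ?ltr0n //.
rewrite subr_eq0 -sqrtrM ?ler0n // -natrM => /eqP e.
(* As a, b <= D, this forces equality: D * D = a * b <= a * D gives D <= a, and symmetrically D <=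
   b. *)
have : (D ^ 2 = a * b)%N.
  by apply/eqP; rewrite -(eqr_nat R) natrX e sqr_sqrtr ?ler0n.
move=> eab; split; right; apply/eqP; rewrite eqn_leq ?leaD ?lebD /=.
  by rewrite -(leq_pmul2r D0) mulnn eab leq_mul2l lebD orbT.
by rewrite -(leq_pmul2l D0) mulnn eab leq_mul2r leaD orbT.
Qed.

Lemma edge_excess_eq0 : d1 = D -> (a = 1%N \/ a = D) -> (b = 1%N \/ b = D) ->
  edge_excess D d1 a b = 0.
Proof.
have D0 : (0 < D)%N by case/andP: aD => a0; exact: leq_trans.
have sD0 : Num.sqrt (D%:R : R) != 0 by rewrite sqrtr_eq0 -ltNge ltr0n.
have pend : D != 1%N -> edge_excess D D 1 D = 0.
  move=> D1; rewrite /edge_excess half_sum_sqrt_ratio ?ltr0n //.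
  by rewrite eqxx (negbTE D1) sqrtr1 addr0 !mul1r; field; rewrite sD0 pnatr_eq0 -lt0n D0.
move=> ed1 Ha Hb; rewrite ed1.
have [ea|a1] := eqVneq a 1%N; have [eb|b1] := eqVneq b 1%N.
- by rewrite ea eb (K2 ea eb) edge_excess11.
- by case: Hb b1 => -> // D1; rewrite ea pend.
- by case: Ha a1 => -> // D1; rewrite eb edge_excessC pend.
case: Ha a1 => -> // D1; case: Hb b1 => -> // _.
by rewrite edge_excess_nonpendent // -expr2 sqr_sqrtr ?ler0n // subrr mulr0.
Qed.

End Bounds.
End EdgeExcess.

(** * Edge sums, degrees and stars in arbitrary graphs *)

Section Graph.
Set Implicit Arguments.
Unset Strict Implicit.
Variables (V : finType) (G : sgraph V).
Implicit Types u v w : V.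

(** Both sides sum [F e.1] over all ordered adjacent pairs: those of decreasing rank are swapped
    edges and account for [F e.2]. Taking for [F] the indicator of degree 1, then the degree, yields
    p and M_1. *)
Lemma sum_edges_endpoints (M : nmodType) (F : V -> M) :
  \sum_(e in edges G) (F e.1 + F e.2) = \sum_v F v *+ degree G v.
Proof.
pose swap (e : V * V) := (e.2, e.1).
have swapK : involutive swap by case.
rewrite big_split /=.
have -> : \sum_v F v *+ degree G v = \sum_(e | adj G e.1 e.2) F e.1.
  rewrite -(pair_big_dep xpredT (fun v w => adj G v w) (fun v _ => F v)) /=.
  by apply: eq_bigr => v _; rewrite sumr_const /degree cardsE.
rewrite [RHS](bigID (fun e => enum_rank e.1 < enum_rank e.2)%N) /=.
congr (_ + _); first by apply: eq_bigl => e; rewrite inE.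
rewrite [RHS](reindex_inj (inv_inj swapK)) /=.
apply: eq_bigl => -[u v]; rewrite inE /= adj_sym -leqNgt.
(* Negating the strict order leaves a weak one; a tie would be a loop. *)
have [Guv|//] := boolP (adj G v u); rewrite /= ltn_neqAle.
have -> // : (nat_of_ord (enum_rank u) != nat_of_ord (enum_rank v)).
by apply: contraTneq Guv => /ord_inj/enum_rank_inj ->; rewrite adj_irr.
Qed.

Lemma adj_edges u v : adj G u v -> (u, v) \in edges G \/ (v, u) \in edges G.
Proof.
move=> Guv; have Gvu : adj G v u by rewrite adj_sym.
rewrite !inE /= Guv Gvu /=.
have [| |/ord_inj/enum_rank_inj euv] := ltngtP (enum_rank u) (enum_rank v).
- by left.
- by right.
- by rewrite euv adj_irr in Guv.
Qed.

Lemma degree_le_max v : (degree G v <= max_degree G)%N.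
Proof. exact: leq_bigmax. Qed.

Lemma degree_lt_order v : (degree G v < #|V|)%N.
Proof.
rewrite -cardsT proper_card // properEneq subsetT andbT.
by apply/eqP => /setP/(_ v); rewrite !inE adj_irr.
Qed.

Lemma adj_degree_gt0 u v : adj G u v -> (0 < degree G u)%N.
Proof. by move=> Guv; apply/card_gt0P; exists v; rewrite inE. Qed.

Lemma min_nonpendent_le v :
  ~~ pendent G v -> (min_nonpendent_degree G <= degree G v)%N.
Proof.
move=> Nv; rewrite /min_nonpendent_degree.
elim: (index_enum V) (mem_index_enum v) => // w s IH; rewrite inE big_cons.
case/orP=> [/eqP <-|/IH le_s]; first by rewrite Nv geq_minl.
by case: ifP => // _; exact: leq_trans (geq_minr _ _) le_s.
Qed.

Lemma min_nonpendent_le_max : (min_nonpendent_degree G <= max_degree G)%N.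
Proof.
rewrite /min_nonpendent_degree; elim/big_rec: _ => // v k _ le_k.
exact: leq_trans (geq_minr _ _) le_k.
Qed.

(** Every term of the minimum is the maximum degree, and so is its initial value, which covers
    graphs whose vertices are all pendent. *)
Lemma min_nonpendent_eq_max :
  (forall v, degree G v = 1%N \/ degree G v = max_degree G) ->
  min_nonpendent_degree G = max_degree G.
Proof.
move=> deg; rewrite /min_nonpendent_degree.
elim/big_rec: _ => // v k Nv ->; rewrite /pendent in Nv.
by case: (deg v) Nv => -> // _; rewrite minnn.
Qed.

Lemma regular_max_degree k : (0 < #|V|)%N ->
  (forall v, degree G v = k) -> max_degree G = k.
Proof.
case/card_gt0P=> v _ degk; apply/eqP; rewrite eqn_leq -{2}(degk v) degree_le_max.
by rewrite andbT; apply/bigmax_leqP => w _; rewrite degk.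
Qed.

Lemma isomorphic_degree (W : finType) (H : sgraph W) (f : V -> W) :
  bijective f -> (forall x y, adj H (f x) (f y) = adj G x y) ->
  forall v, degree G v = degree H (f v).
Proof.
move=> fbij fadj v; rewrite /degree -(on_card_preimset (f := f)).
  by apply: eq_card => w; rewrite !inE fadj.
exact: onW_bij.
Qed.

Lemma star_degree k (x : 'I_1 + 'I_k) :
  degree (complete_bipartite 1 k) x = if x is inl _ then k else 1%N.
Proof.
rewrite /degree; case: x => i.
  rewrite -[RHS]card_ord -(card_codom (@inr_inj 'I_1 'I_k)).
  apply: eq_card => -[j|j]; rewrite !inE /= /cbip_adj /=.
    by apply/esym/codomP => -[].
  by apply/esym/codomP; exists j.
rewrite -[RHS](card_ord 1) -(card_codom (@inl_inj 'I_1 'I_k)).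
apply: eq_card => -[j|j]; rewrite !inE /= /cbip_adj /=.
  by apply/esym/codomP; exists j.
by apply/esym/codomP => -[].
Qed.

(** * Connected graphs and the extremal degree condition *)

Section Connected.
Hypothesis Gconn : connected_graph G.

Lemma connected_neighbour u v : u != v -> exists w, adj G u w.
Proof.
move=> uv; have /connectP[[|w s] /= ps ev] := Gconn.2 u v.
  by rewrite ev eqxx in uv.
by case/andP: ps => ? _; exists w.
Qed.

(** The edge rules out the one-vertex graph, the only connected graph with an isolated vertex. *)
Lemma connected_degree_gt0 u v w : adj G u v -> (0 < degree G w)%N.
Proof.
move=> Guv; have [<-|wu] := eqVneq u w; first exact: adj_degree_gt0 Guv.
rewrite eq_sym in wu; have [x] := connected_neighbour wu; exact: adj_degree_gt0.
Qed.

(** Each of [u], [v] is the other's only neighbour, so no path leaves the pair and connectedness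
    makes it the whole graph. *)
Lemma pendent_adj_max_degree u v :
  adj G u v -> degree G u = 1%N -> degree G v = 1%N -> max_degree G = 1%N.
Proof.
move=> Guv du dv.
have nbr x y : adj G x y -> degree G x = 1%N -> forall z, adj G x z -> z = y.
  move=> Gxy /eqP/cards1P[t et] z Gxz.
  have /set1P -> : z \in [set t] by rewrite -et inE.
  by apply/esym/set1P; rewrite -et inE.
have reach w : connect (adj G) u w -> w = u \/ w = v.
  case/connectP=> s; elim/last_ind: s w => [|s x IH] w /=; first by left.
  rewrite rcons_path last_rcons => /andP[ps Gx] ->.
  case: (IH _ ps erefl) Gx => -> Gx; first by right; exact: (nbr u v).
  by left; apply: (nbr v u) => //; rewrite adj_sym.
apply/eqP; rewrite eqn_leq -{2}du degree_le_max andbT.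
apply/bigmax_leqP => w _.
by case: (reach w (Gconn.2 u w)) => ->; rewrite ?du ?dv.
Qed.

Lemma extremal_degreesP :
  (forall v, degree G v = 1%N \/ degree G v = max_degree G) <->
  [\/ isomorphic G (complete_bipartite 1 (#|V| - 1)),
      regular_graph G
    | semiregular G (max_degree G) 1].
Proof.
split=> [deg|[[f fbij fadj] v|[k degk] v|]].
(* If all vertices or none are pendent, the graph is regular; otherwise the pendent and non-pendent
   vertices are the two classes. *)
- have [/forallP allp|] := boolP [forall v, pendent G v].
    by constructor 2; exists 1%N => v; apply/eqP/allp.
  rewrite negb_forall => /existsP[x Nx].
  have [/existsP[y py]|] := boolP [exists v, pendent G v]; last first.
    rewrite negb_exists => /forallP nop; constructor 2; exists (max_degree G) => v.
    by case: (deg v) => // dv; have := nop v; rewrite /pendent dv.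
  constructor 3; exists [set v | ~~ pendent G v], [set v | pendent G v]; split.
  + by apply/setP => v; rewrite !inE; case: (pendent G v).
  + by rewrite -setI_eq0; apply/eqP/setP => v; rewrite !inE; case: (pendent G v).
  + by split; apply/set0Pn; [exists x|exists y]; rewrite inE.
  + by move=> v; rewrite inE /pendent; case: (deg v) => ->.
  + by move=> v; rewrite inE => /eqP.
- rewrite (isomorphic_degree fbij fadj) star_degree.
  case ef: (f v) => [i|j]; last by left.
  right; apply/eqP; rewrite eqn_leq.
  (* [v] is the centre, and no degree exceeds n - 1. *)
  have dv : degree G v = (#|V| - 1)%N.
    by rewrite (isomorphic_degree fbij fadj) star_degree ef.
  rewrite -{1}dv degree_le_max /=; apply/bigmax_leqP => w _.
  by have := degree_lt_order w; case: #|V| => // k; rewrite subn1.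
- by right; rewrite degk (regular_max_degree _ degk) //; case: Gconn.
case=> V1 [V2 [VU _ _ d1 d2]] v.
have : v \in V1 :|: V2 by rewrite VU inE.
by case/setUP => [/d1|/d2]; [right|left].
Qed.

(** * Summing the excess over the edges *)

Section Excess.
Variable R : rcfType.
Let Delta := max_degree G.
Let delta1 := min_nonpendent_degree G.
Let p := num_pendent G.

Definition AG_lower_bound : R :=
  p%:R * (delta1%:R + 1) / (2 * Num.sqrt delta1%:R)
  + 1 / (2 * Delta%:R) * ((first_zagreb G)%:R - p%:R * (Delta%:R + 1)).

(* Also valid for Delta = 0, whatever value is given to 1 / 0. *)
Lemma sum_edge_excess :
  AG_index G R - AG_lower_bound
  = \sum_(e in edges G) edge_excess R Delta delta1 (degree G e.1) (degree G e.2).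
Proof.
rewrite /edge_excess !sumrB -/(AG_index G R) -!mulr_suml.
rewrite (sum_edges_endpoints (fun v => (degree G v == 1%N)%:R)).
rewrite (sum_edges_endpoints (fun v => (degree G v)%:R)).
(* The multiplicity is 1 wherever the indicator is nonzero. *)
have -> : \sum_v (degree G v == 1%N)%:R *+ degree G v = p%:R :> R.
  rewrite /p /num_pendent -sum1_card natr_sum [RHS]big_mkcond /=.
  by apply: eq_bigr => v _; rewrite inE /pendent; case: eqP => [->|_]; rewrite ?mul0rn.
have -> : \sum_v (degree G v)%:R *+ degree G v = (first_zagreb G)%:R :> R.
  rewrite /first_zagreb natr_sum; apply: eq_bigr => v _.
  by rewrite natrX expr2 mulr_natr.
rewrite /AG_lower_bound; ring.
Qed.

Lemma edge_excess_graph_hyps u v : adj G u v ->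
  [/\ (0 < delta1)%N, (0 < degree G u <= Delta)%N
    & degree G u != 1%N -> (delta1 <= degree G u)%N].
Proof.
move=> Guv; split=> [||Nu]; last exact: min_nonpendent_le.
(* The initial value Delta is positive because of the edge at [u]. *)
- rewrite /delta1 /min_nonpendent_degree; elim/big_rec: _ => [|w k _ k0].
    exact: leq_trans (connected_degree_gt0 u Guv) (degree_le_max u).
  by rewrite leq_min (connected_degree_gt0 w Guv).
- by rewrite (adj_degree_gt0 Guv) degree_le_max.
Qed.

Lemma edge_excess_graph u v : adj G u v ->
  let h := edge_excess R Delta delta1 (degree G u) (degree G v) in
  [/\ 0 <= h,
      h = 0 -> degree G u = 1%N \/ degree G u = Delta,
      h = 0 -> degree G v = 1%N \/ degree G v = Delta
    & (forall w, degree G w = 1%N \/ degree G w = Delta) -> h = 0].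
Proof.
move=> Guv h; have Gvu : adj G v u by rewrite adj_sym.
have [d0 uD du] := edge_excess_graph_hyps Guv.
have [_ vD dv] := edge_excess_graph_hyps Gvu.
have K2 := pendent_adj_max_degree Guv; have d1D := min_nonpendent_le_max.
split.
- exact: edge_excess_ge0.
- by case/edge_excess_eq0_impl.
- by case/edge_excess_eq0_impl.
- by move=> deg; apply: edge_excess_eq0 => //; exact: min_nonpendent_eq_max.
Qed.

Lemma edges_adj e : e \in edges G -> adj G e.1 e.2.
Proof. by rewrite inE => /andP[]. Qed.

Lemma AG_lower_bound_le : AG_lower_bound <= AG_index G R.
Proof.
rewrite -subr_ge0 sum_edge_excess; apply: sumr_ge0 => e /edges_adj/edge_excess_graph.
by case.
Qed.

Lemma AG_lower_bound_eqP :
  AG_index G R = AG_lower_bound <->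
  forall v, degree G v = 1%N \/ degree G v = Delta.
Proof.
have ge0 e : e \in edges G ->
    0 <= edge_excess R Delta delta1 (degree G e.1) (degree G e.2).
  by move=> /edges_adj/edge_excess_graph[].
split=> [AGE v|deg]; last first.
  apply/eqP; rewrite -subr_eq0 sum_edge_excess big1 // => e /edges_adj.
  by case/edge_excess_graph => _ _ _ ->.
have := sum_edge_excess; rewrite AGE subrr => /esym/eqP.
rewrite psumr_eq0 // => /allP eq0.
have {eq0} eq0 e : e \in edges G ->
    edge_excess R Delta delta1 (degree G e.1) (degree G e.2) = 0.
  by move=> eE; apply/eqP; have /implyP := eq0 e (mem_index_enum _); exact.
have [/existsP[w Gvw]|] := boolP [exists w, adj G v w].
  case: (adj_edges Gvw) => eE; have [_ H1 H2 _] := edge_excess_graph (edges_adj eE).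
    exact: H1 (eq0 _ eE).
  exact: H2 (eq0 _ eE).
(* An isolated vertex of a connected graph is its only vertex, so its degree is Delta. *)
rewrite negb_exists => /forallP noadj; right.
have sing w : w = v.
  have [//|wv] := eqVneq w v; rewrite eq_sym in wv.
  by have [x Gvx] := connected_neighbour wv; rewrite (negbTE (noadj x)) in Gvx.
apply/esym/regular_max_degree; first by case: Gconn.
by move=> w; rewrite (sing w).
Qed.

End Excess.
End Connected.
End Graph.

Theorem theorem6 (R : rcfType) (V : finType) (G : sgraph V)
    (n m Delta delta1 p : nat)
    (Gconn : connected_graph G)
    (Gorder : #|V| = n)
    (Gsize : #|edges G| = m)
    (GDelta : max_degree G = Delta)
    (Gdelta1 : min_nonpendent_degree G = delta1)
    (Gp : num_pendent G = p) :
  let bound : R :=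
    p%:R * (delta1%:R + 1) / (2 * Num.sqrt delta1%:R)
    + 1 / (2 * Delta%:R) * ((first_zagreb G)%:R - p%:R * (Delta%:R + 1)) in
  bound <= AG_index G R
  /\ (AG_index G R = bound <->
      [\/ isomorphic G (complete_bipartite 1 (n - 1)),
          regular_graph G
        | semiregular G Delta 1]).
Proof.
rewrite -Gorder -GDelta -Gdelta1 -Gp; split; first exact: AG_lower_bound_le.
exact: iff_trans (AG_lower_bound_eqP Gconn R) (extremal_degreesP Gconn).
Qed.
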